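(* Let $(M,d,0)$ be a pointed proper metric space. The restriction map $$R:\mathcal F(M)\to G_0(M)^*,\qquad R\mu=\mu|_{G_0(M)},$$ is an isometric embedding. Consequently, its adjoint $$R^*:G_0(M)^{**}\to \mathcal F(M)^*=\operatorname{Lip}_0(M)$$ is a contractive weak-star continuous quotient map. Moreover, $R^*$ extends the canonical inclusion $G_0(M)\hookrightarrow\operatorname{Lip}_0(M)$; that is, $R^*\kappa(g)=g$ for every $g\in G_0(M)$, where $\kappa:G_0(M)\to G_0(M)^{**}$ is the canonical embedding.
   Context: All Banach spaces are real. A metric space is proper if its closed bounded subsets are compact. For a pointed metric space $(M,d,0)$, $\operatorname{Lip}_0(M)$ is the Banach space of all Lipschitz $f:M\to\mathbb R$ with $f(0)=0$, with norm $\|f\|_{\operatorname{Lip}}=\sup_{x\neq y}|f(x)-f(y)|/d(x,y)$. The Lipschitz-free space is $\mathcal F(M)=\overline{\operatorname{span}}\{\delta(x):x\in M\}\subset\operatorname{Lip}_0(M)^*$, where $\langle f,\delta(x)\rangle=f(x)$; one has $\operatorname{Lip}_0(M)=\mathcal F(M)^*$ isometrically and canonically. $\operatorname{Lip}_{0,c}(M)$ is the set of $f\in\operatorname{Lip}_0(M)$ whose closed support is compact, and $G_0(M):=\overline{\operatorname{Lip}_{0,c}(M)}^{\|\cdot\|_{\operatorname{Lip}}}\subset\operatorname{Lip}_0(M)$ with the norm $\|\cdot\|_{\operatorname{Lip}}$. A quotient map (metric quotient map) between Banach spaces is a bounded surjection inducing an isometric isomorphism from the domain modulo the kernel onto the target.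 *)

(* Defs.v *)
From HB Require Import structures.
From mathcomp Require Import all_boot all_order all_algebra.
From mathcomp Require Import all_classical all_reals all_analysis.

Set Implicit Arguments.
Unset Strict Implicit.
Unset Printing Implicit Defensive.

Import Order.TTheory GRing.Theory Num.Theory.
Import numFieldNormedType.Exports.

Local Open Scope classical_set_scope.
Local Open Scope ring_scope.

(* Elements of bop V W are the continuous linear operators V -> W. *)
Definition bop_pred {R : realType} (V W : normedModType R) : {pred V -> W} :=
  [pred f : V -> W | `[< linear f /\ continuous f >]].

Section bop_closed.
Context {R : realType} (V W : normedModType R).

Lemma bop_predP (f : V -> W) :
  reflect (linear f /\ continuous f) (f \in @bop_pred R V W).
Proof. exact: asboolP. Qed.

Lemma bop_submod_closed : GRing.submod_closed (@bop_pred R V W).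
Proof.
split.
  apply/bop_predP; split; first by move=> a x y; rewrite scaler0 addr0.
  by move=> x; exact: cvg_cst.
move=> a f g /bop_predP[lf cf] /bop_predP[lg cg].
apply/bop_predP; split.
  move=> b x y; rewrite !fctE lf lg !scalerDr !scalerA (mulrC a b).
  by rewrite addrACA.
by move=> x; apply: cvgD; [apply: cvgZl_tmp; exact: cf|exact: cg].
Qed.

HB.instance Definition _ :=
  GRing.isSubmodClosed.Build R (V -> W) (@bop_pred R V W) bop_submod_closed.

End bop_closed.

Record bop {R : realType} (V W : normedModType R) :=
  Bop { bop_fun :> V -> W ; _ : bop_fun \in @bop_pred R V W }.

Section bop_instances.
Context {R : realType} (V W : normedModType R).

HB.instance Definition _ := [isSub for @bop_fun R V W].
HB.instance Definition _ := [Choice of bop V W by <:].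
HB.instance Definition _ := [SubChoice_isSubLmodule of bop V W by <:].

Implicit Types f g : bop V W.

Lemma bop_linear f : linear f.
Proof. by have /bop_predP[] := valP f. Qed.

Lemma bop_continuous f : continuous f.
Proof. by have /bop_predP[] := valP f. Qed.

HB.instance Definition _ f := GRing.isLinear.Build R V W *:%R f (bop_linear f).

Lemma bopP f g : f =1 g -> f = g.
Proof. by move=> fg; apply/val_inj/funext. Qed.

Lemma bop_linE (a : R) f g x : (a *: f + g) x = a *: f x + g x.
Proof. by []. Qed.

Lemma bop_bounded f : exists2 C, 0 <= C & forall x, `|f x| <= C * `|x|.
Proof.
have /linear_boundedP : bounded_near f (nbhs 0).
  exact/continuous_linear_bounded/bop_continuous.
by move=> /pinfty_ex_gt0[C C0 Cf]; exists C => //; exact: ltW.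
Qed.

Definition op_norm f : R := sup [set `|f x| | x in [set x | `|x| <= 1]].

Lemma op_norm_has_sup f : has_sup [set `|f x| | x in [set x | `|x| <= 1]].
Proof.
split; first by exists `|f 0|, 0 => //=; rewrite normr0.
have [C C0 Cf] := bop_bounded f; exists C => _ [x /= x1 <-].
by rewrite (le_trans (Cf x))// ler_piMr.
Qed.

Lemma op_norm_le1 f x : `|x| <= 1 -> `|f x| <= op_norm f.
Proof. by move=> x1; apply: (sup_upper_bound (op_norm_has_sup f)); exists x. Qed.

Lemma op_norm_ge0 f : 0 <= op_norm f.
Proof. by rewrite (le_trans (normr_ge0 (f 0)))// op_norm_le1// normr0. Qed.

Lemma op_norm_le f x : `|f x| <= op_norm f * `|x|.
Proof.
have [->|x0] := eqVneq x 0; first by rewrite linear0 !normr0 mulr0.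
have nx : 0 < `|x| by rewrite normr_gt0.
have := @op_norm_le1 f (`|x|^-1 *: x).
rewrite normrZ normfV normr_id mulVf ?gt_eqF// => /(_ (lexx _)).
by rewrite linearZ/= normrZ normfV normr_id mulrC ler_pdivrMr.
Qed.

Lemma op_norm_lub f C : 0 <= C -> (forall x, `|f x| <= C * `|x|) -> op_norm f <= C.
Proof.
move=> C0 Cf; apply: ge_sup; first by case: (op_norm_has_sup f).
by move=> _ [x /= x1 <-]; rewrite (le_trans (Cf x))// ler_piMr.
Qed.

Lemma op_normD f g : op_norm (f + g) <= op_norm f + op_norm g.
Proof.
apply: op_norm_lub; first by rewrite addr_ge0// op_norm_ge0.
move=> x; rewrite mulrDl (le_trans (ler_normD _ _))//.
by rewrite lerD// op_norm_le.
Qed.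

Lemma op_normZ_le (a : R) f : op_norm (a *: f) <= `|a| * op_norm f.
Proof.
apply: op_norm_lub; first by rewrite mulr_ge0// op_norm_ge0.
by move=> x; rewrite normrZ -mulrA ler_wpM2l// op_norm_le.
Qed.

Lemma op_norm_eq0 f : op_norm f = 0 -> f = 0.
Proof.
move=> f0; apply: bopP => x; apply/eqP; rewrite -normr_le0.
by rewrite (le_trans (op_norm_le f x))// f0 mul0r.
Qed.

Lemma op_normZ (a : R) f : op_norm (a *: f) = `|a| * op_norm f.
Proof.
apply/eqP; rewrite eq_le op_normZ_le/=.
have [->|a0] := eqVneq a 0; first by rewrite normr0 mul0r op_norm_ge0.
rewrite mulrC -ler_pdivlMr ?normr_gt0// mulrC -normfV.
by rewrite -{1}(scale1r f) -(mulVf a0) -scalerA op_normZ_le.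
Qed.

HB.instance Definition _ :=
  Lmodule_isNormed.Build R (bop V W) op_normD op_normZ op_norm_eq0.

End bop_instances.

Lemma bop_bound_subproof {R : realType} (V W : normedModType R)
    (f : V -> W) (C : R) :
  linear f -> (forall x, `|f x| <= C * `|x|) -> f \in @bop_pred R V W.
Proof.
move=> lf fC; apply/bop_predP; split=> //.
pose L := GRing.isLinear.Build R V W *:%R f lf.
pose g : {linear V -> W} := HB.pack f L.
apply: (@bounded_linear_continuous _ _ _ g); apply/linear_boundedP.
near=> r => x; rewrite (le_trans (fC x))// ler_wpM2r//.
Unshelve. all: by end_near. Qed.

Definition mk_bop {R : realType} (V W : normedModType R) (f : V -> W) (C : R)
  (lf : linear f) (fC : forall x, `|f x| <= C * `|x|) : bop V W :=
  Bop (bop_bound_subproof lf fC).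

Definition dual {R : realType} (V : normedModType R) := bop V R^o.

Record subnormed {R : realType} (V : normedModType R) (S : submodClosed V) :=
  Subnormed { subnormed_val :> V ; _ : subnormed_val \in S }.

Section subnormed_instances.
Context {R : realType} (V : normedModType R) (S : submodClosed V).

HB.instance Definition _ := [isSub for @subnormed_val R V S].
HB.instance Definition _ := [Choice of subnormed S by <:].
HB.instance Definition _ := [SubChoice_isSubLmodule of subnormed S by <:].

Definition subnormed_norm (x : subnormed S) : R := `|subnormed_val x|.

Lemma subnormed_normD x y :
  subnormed_norm (x + y) <= subnormed_norm x + subnormed_norm y.
Proof. exact: ler_normD. Qed.

Lemma subnormed_normZ a x : subnormed_norm (a *: x) = `|a| * subnormed_norm x.
Proof. exact: normrZ. Qed.

Lemma subnormed_norm_eq0 x : subnormed_norm x = 0 -> x = 0.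
Proof. by move=> /normr0_eq0 x0; apply: val_inj. Qed.

HB.instance Definition _ := Lmodule_isNormed.Build R (subnormed S)
  subnormed_normD subnormed_normZ subnormed_norm_eq0.

End subnormed_instances.

Definition restrict {R : realType} (V : normedModType R) (S : submodClosed V)
  (phi : dual V) : subnormed S -> R^o := fun x => phi (subnormed_val x).

Section duality.
Context {R : realType}.

Lemma restrict_linear (V : normedModType R) (S : submodClosed V) (phi : dual V) :
  linear (@restrict R V S phi).
Proof. by move=> a x y; rewrite /restrict/= linearP. Qed.

Lemma restrict_bound (V : normedModType R) (S : submodClosed V) (phi : dual V)
  (x : subnormed S) : `|restrict phi x| <= `|phi| * `|x|.
Proof. exact: op_norm_le. Qed.

Definition restriction (V : normedModType R) (S : submodClosed V) (phi : dual V) :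
  dual (subnormed S) := mk_bop (restrict_linear phi) (@restrict_bound V S phi).

Definition adjoint_fun (V W : normedModType R) (T : bop V W) (psi : dual W) :
  V -> R^o := psi \o T.

Lemma adjoint_fun_linear (V W : normedModType R) (T : bop V W) (psi : dual W) :
  linear (adjoint_fun T psi).
Proof. by move=> a x y; rewrite /adjoint_fun/= !linearP. Qed.

Lemma adjoint_fun_bound (V W : normedModType R) (T : bop V W) (psi : dual W) x :
  `|adjoint_fun T psi x| <= (`|psi| * `|T|) * `|x|.
Proof.
rewrite -mulrA (le_trans (op_norm_le psi (T x)))//.
by apply: ler_wpM2l; [exact: op_norm_ge0|exact: op_norm_le].
Qed.

Definition adjoint_val (V W : normedModType R) (T : bop V W) (psi : dual W) :
  dual V := mk_bop (adjoint_fun_linear T psi) (adjoint_fun_bound T psi).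

Lemma adjoint_val_linear (V W : normedModType R) (T : bop V W) :
  linear (adjoint_val T).
Proof. by move=> a f g; apply: bopP. Qed.

Lemma adjoint_val_bound (V W : normedModType R) (T : bop V W) psi :
  `|adjoint_val T psi| <= `|T| * `|psi|.
Proof.
rewrite mulrC; apply: op_norm_lub; last exact: adjoint_fun_bound.
by rewrite mulr_ge0.
Qed.

Definition adjoint (V W : normedModType R) (T : bop V W) :
  bop (dual W) (dual V) :=
  mk_bop (@adjoint_val_linear V W T) (@adjoint_val_bound V W T).

Definition eval_at (V : normedModType R) (x : V) : dual V -> R^o :=
  fun phi => phi x.

Lemma eval_at_linear (V : normedModType R) (x : V) : linear (eval_at x).
Proof. by []. Qed.

Lemma eval_at_bound (V : normedModType R) (x : V) phi :
  `|eval_at x phi| <= `|x| * `|phi|.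
Proof. by rewrite mulrC; exact: op_norm_le. Qed.

Definition bidual_map (V : normedModType R) (x : V) : dual (dual V) :=
  mk_bop (eval_at_linear x) (eval_at_bound x).

(* The weak-star topology: pointwise convergence on V. *)
Definition weak_star (V : normedModType R) : topologicalType :=
  initial_topology (fun phi : dual V => (phi : {ptws V -> R})).

Definition weak_star_continuous (V W : normedModType R)
  (T : dual V -> dual W) := continuous (T : weak_star V -> weak_star W).

Definition isometric_embedding (V W : normedModType R) (T : bop V W) :=
  forall x, `|T x| = `|x|.

Definition contractive (V W : normedModType R) (T : bop V W) :=
  forall x, `|T x| <= `|x|.

Definition ker_coset (V W : normedModType R) (T : bop V W) (x : V) : set V :=
  [set x + z | z in [set z | T z = 0]].

(* For A a coset of a subspace, this is the norm of A in the quotient space. *)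
Definition quotient_norm (V : normedModType R) (A : set V) : R :=
  inf [set `|v| | v in A].

(* The linear bijection V / ker T -> W, x + ker T |-> T x, which T induces
   when it is onto, preserves the norm. *)
Definition metric_quotient_map (V W : normedModType R) (T : bop V W) :=
  (forall y, exists x, T x = y) /\
  (forall x, `|T x| = quotient_norm (ker_coset T x)).

End duality.

Section closed_span.
Context {R : realType} (V : normedModType R).
Implicit Type A : set V.

Definition lspan A : set V := [set v | exists (n : nat) (c : 'I_n -> R)
  (a : 'I_n -> V), (forall i, A (a i)) /\ v = \sum_i c i *: a i].

Definition linear_set A := A 0 /\ forall a u v, A u -> A v -> A (a *: u + v).

Definition closure_pred A : {pred V} := [pred v | `[< closure A v >]].

Lemma closure_predP A v : reflect (closure A v) (v \in closure_pred A).
Proof. exact: asboolP. Qed.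

Lemma lspan_sub A : A `<=` lspan A.
Proof.
move=> v Av; exists 1%N, (fun=> 1), (fun=> v).
by rewrite big_ord1 scale1r.
Qed.

Lemma lspan_linear A : linear_set (lspan A).
Proof.
split.
  by exists 0%N, (fun=> 0), (fun=> 0); split=> [[]//|]; rewrite big_ord0.
move=> k _ _ [n [c [a [Aa ->]]]] [m [d [b [Ab ->]]]].
exists (n + m)%N,
  (fun i : 'I_(n + m) => match fintype.split i with inl j => k * c j | inr j => d j end),
  (fun i : 'I_(n + m) => match fintype.split i with inl j => a j | inr j => b j end).
split=> [i|]; first by case: (fintype.split i).
rewrite big_split_ord scaler_sumr/=; congr (_ + _); apply: eq_bigr => i _.
  by rewrite (unsplitK (inl i)) scalerA.
by rewrite (unsplitK (inr i)).
Qed.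

Lemma closureE_dist A v :
  closure A v <-> forall e : R, 0 < e -> exists2 w, A w & `|v - w| < e.
Proof.
split=> [cA e e0|H B].
  have [w [Aw vw]] := cA (ball v e) (nbhsx_ballx _ _ e0).
  by exists w => //; move: vw; rewrite -ball_normE.
move=> /nbhs_ballP[e e0 eB]; have [w Aw vw] := H e e0.
by exists w; split=> //; apply: eB; rewrite -ball_normE.
Qed.

Lemma closure_submod_closed A : linear_set A ->
  GRing.submod_closed (closure_pred A).
Proof.
move=> [A0 AD]; split; first by apply/closure_predP; exact: subset_closure.
move=> a u v /closure_predP/closureE_dist Au /closure_predP/closureE_dist Av.
apply/closure_predP/closureE_dist => e e0.
have a1 : 0 < `|a| + 1 by rewrite ltr_wpDl.
have [u' Au' uu'] := Au (e / 2 / (`|a| + 1)) ltac:(by rewrite !divr_gt0).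
have [v' Av' vv'] := Av (e / 2) ltac:(by rewrite divr_gt0).
exists (a *: u' + v'); first exact: AD.
rewrite opprD addrACA -scalerBr (splitr e) (le_lt_trans (ler_normD _ _))//.
rewrite ler_ltD// normrZ.
rewrite (@le_trans _ _ ((`|a| + 1) * `|u - u'|))//.
  by rewrite ler_wpM2r// lerDl.
by rewrite mulrC -ler_pdivlMr// ltW.
Qed.

End closed_span.

Definition proper_metric_space {R : realType} (M : metricType R) :=
  forall A : set M, closed A ->
    (exists r : R, forall x y, A x -> A y -> mdist x y <= r) -> compact A.

Definition is_lipschitz {R : realType} (M : metricType R) (f : M -> R) :=
  exists C : R, forall x y, `|f x - f y| <= C * mdist x y.

Definition lip0_pred {R : realType} (M : metricType R) (o : M) :
  {pred M -> R^o} := [pred f : M -> R^o | `[< is_lipschitz f /\ f o = 0 >]].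

Section lip0_closed.
Context {R : realType} (M : metricType R) (o : M).

Lemma lip0_predP (f : M -> R^o) :
  reflect (is_lipschitz f /\ f o = 0) (f \in lip0_pred o).
Proof. exact: asboolP. Qed.

Lemma lip0_submod_closed : GRing.submod_closed (lip0_pred o).
Proof.
split.
  apply/lip0_predP; split=> //; exists 0 => x y.
  by rewrite subrr normr0 mul0r.
move=> a f g /lip0_predP[[C fC] f0] /lip0_predP[[D gD] g0].
apply/lip0_predP; split; last by rewrite !fctE f0 g0 scaler0 addr0.
exists (`|a| * C + D) => x y; rewrite !fctE opprD addrACA -scalerBr mulrDl.
rewrite (le_trans (ler_normD _ _))// lerD// normrZ -mulrA.
by rewrite ler_wpM2l.
Qed.

HB.instance Definition _ :=
  GRing.isSubmodClosed.Build R (M -> R^o) (lip0_pred o) lip0_submod_closed.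

End lip0_closed.

Record lip0 {R : realType} (M : metricType R) (o : M) :=
  Lip0 { lip0_fun :> M -> R^o ; _ : lip0_fun \in lip0_pred o }.

Section lip0_instances.
Context {R : realType} (M : metricType R) (o : M).

HB.instance Definition _ := [isSub for @lip0_fun R M o].
HB.instance Definition _ := [Choice of lip0 o by <:].
HB.instance Definition _ := [SubChoice_isSubLmodule of lip0 o by <:].

Implicit Types f g : lip0 o.

Lemma lip0_base f : f o = 0.
Proof. by have /lip0_predP[] := valP f. Qed.

Lemma lip0P f g : f =1 g -> f = g.
Proof. by move=> fg; apply/val_inj/funext. Qed.

Definition lip_norm f : R :=
  sup [set `|f p.1 - f p.2| / mdist p.1 p.2 | p in [set p : M * M | p.1 <> p.2]].

Lemma lip_norm_ubound f : has_ubound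
  [set `|f p.1 - f p.2| / mdist p.1 p.2 | p in [set p : M * M | p.1 <> p.2]].
Proof.
have /lip0_predP[[C fC] _] := valP f.
exists C => _ [[x y] /= xy <-]; have d0 : 0 < mdist x y by rewrite mdist_gt0; exact/eqP.
by rewrite /= ler_pdivrMr; [exact: fC|].
Qed.

Lemma lip_norm_ge0 f : 0 <= lip_norm f.
Proof.
have [[p pxy]|] := pselect
    (exists p : M * M, p.1 <> p.2).
  apply: (@le_trans _ _ (`|f p.1 - f p.2| / mdist p.1 p.2)).
    by rewrite divr_ge0// mdist_ge0.
  by apply: (ub_le_sup (lip_norm_ubound f)); exists p.
move=> H; rewrite /lip_norm; set E := (X in sup X).
rewrite (_ : E = set0) ?sup0//.
by apply/seteqP; split=> // t [p pxy _]; case: H; exists p.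
Qed.

Lemma lip_norm_le f x y : `|f x - f y| <= lip_norm f * mdist x y.
Proof.
have [->|xy] := eqVneq x y; first by rewrite subrr normr0 mdistxx mulr0.
rewrite -ler_pdivrMr ?mdist_gt0//.
by apply: (ub_le_sup (lip_norm_ubound f)); exists (x, y) => //=; exact/eqP.
Qed.

Lemma lip_norm_lub f C : 0 <= C ->
  (forall x y, `|f x - f y| <= C * mdist x y) -> lip_norm f <= C.
Proof.
move=> C0 fC; rewrite /lip_norm; set E := (X in sup X).
have [/ge_sup|] := pselect (E !=set0).
  apply=> _ [[x y] /= xy <-]; have d0 : 0 < mdist x y by rewrite mdist_gt0; exact/eqP.
  by rewrite /= ler_pdivrMr.
by move=> /set0P/negP/negPn/eqP ->; rewrite sup0.
Qed.

Lemma lip_normD f g : lip_norm (f + g) <= lip_norm f + lip_norm g.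
Proof.
apply: lip_norm_lub => [|x y]; first by rewrite addr_ge0// lip_norm_ge0.
rewrite mulrDl opprD addrACA (le_trans (ler_normD _ _))//.
by rewrite lerD// lip_norm_le.
Qed.

Lemma lip_normZ_le (a : R) f : lip_norm (a *: f) <= `|a| * lip_norm f.
Proof.
apply: lip_norm_lub => [|x y]; first by rewrite mulr_ge0// lip_norm_ge0.
by rewrite -scalerBr normrZ -mulrA ler_wpM2l// lip_norm_le.
Qed.

Lemma lip_norm_eq0 f : lip_norm f = 0 -> f = 0.
Proof.
move=> f0; apply: lip0P => x; apply/eqP; rewrite -normr_le0.
by have := lip_norm_le f x o; rewrite f0 mul0r lip0_base subr0.
Qed.

Lemma lip_normZ (a : R) f : lip_norm (a *: f) = `|a| * lip_norm f.
Proof.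
apply/eqP; rewrite eq_le lip_normZ_le/=.
have [->|a0] := eqVneq a 0; first by rewrite normr0 mul0r lip_norm_ge0.
rewrite mulrC -ler_pdivlMr ?normr_gt0// mulrC -normfV.
by rewrite -{1}(scale1r f) -(mulVf a0) -scalerA lip_normZ_le.
Qed.

HB.instance Definition _ :=
  Lmodule_isNormed.Build R (lip0 o) lip_normD lip_normZ lip_norm_eq0.

Definition dirac_fun (x : M) : lip0 o -> R^o := fun f => f x.

Lemma dirac_linear x : linear (dirac_fun x).
Proof. by []. Qed.

Lemma dirac_bound x f : `|dirac_fun x f| <= mdist x o * `|f|.
Proof. by have := lip_norm_le f x o; rewrite lip0_base subr0 mulrC. Qed.

Definition delta (x : M) : dual (lip0 o) :=
  mk_bop (@dirac_linear x) (@dirac_bound x).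

Definition lip_support f : set M := closure [set x | f x <> 0].

Definition lip0c : set (lip0 o) := [set f | compact (lip_support f)].

Lemma lip0c_linear : linear_set lip0c.
Proof.
split.
  rewrite /lip0c/= /lip_support (_ : [set _ | _] = set0).
    by rewrite closure0; exact: compact0.
  by apply/seteqP; split=> // x; apply.
move=> a f g cf cg; apply: (subclosed_compact _ (compactU cf cg)).
  exact: closed_closure.
rewrite -closureU; apply: closureS => x /= fg.
apply: contrapT => /not_orP[/= /contrapT f0 /contrapT g0].
apply: fg; change (a *: f x + g x = 0).
by rewrite [f x]f0 [g x]g0 scaler0 addr0.
Qed.

End lip0_instances.
Arguments lip0c {R M} o.
Arguments delta {R M} o x.

Definition free_pred {R : realType} (M : metricType R) (o : M) :
  {pred dual (lip0 o)} := closure_pred (lspan (range (delta o))).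

Definition G0_pred {R : realType} (M : metricType R) (o : M) :
  {pred lip0 o} := closure_pred (lip0c o).

Arguments free_pred {R M} o.
Arguments G0_pred {R M} o.

Section spaces.
Context {R : realType} (M : metricType R) (o : M).

HB.instance Definition _ := GRing.isSubmodClosed.Build R (dual (lip0 o))
  (free_pred o) (closure_submod_closed (lspan_linear _)).

HB.instance Definition _ := GRing.isSubmodClosed.Build R (lip0 o)
  (G0_pred o) (closure_submod_closed (@lip0c_linear R M o)).

Definition lip_free : normedModType R := subnormed (free_pred o).

Definition G0 : normedModType R := subnormed (G0_pred o).

Definition free_restriction_fun (mu : lip_free) : dual G0 :=
  restriction (G0_pred o) (subnormed_val mu).

Lemma free_restriction_linear : linear free_restriction_fun.
Proof.
move=> a mu nu; apply: bopP => g; rewrite bop_linE.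
have -> : free_restriction_fun (a *: mu + nu) g =
  subnormed_val (a *: mu + nu) (subnormed_val g) by [].
exact: bop_linE.
Qed.

Lemma free_restriction_bound (mu : lip_free) :
  `|free_restriction_fun mu| <= 1 * `|mu|.
Proof.
by rewrite mul1r; apply: op_norm_lub => // g; exact: restrict_bound.
Qed.

Definition free_restriction : bop lip_free (dual G0) :=
  mk_bop free_restriction_linear free_restriction_bound.

Definition pairing (f : lip0 o) : lip_free -> R^o :=
  fun mu => (subnormed_val mu : dual (lip0 o)) f.

Lemma pairing_linear f : linear (pairing f).
Proof. by move=> a mu nu; rewrite /pairing; exact: bop_linE. Qed.

Lemma pairing_bound f mu : `|pairing f mu| <= `|f| * `|mu|.
Proof. by rewrite mulrC; exact: op_norm_le. Qed.

Definition lip0_dual_fun (f : lip0 o) : dual lip_free :=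
  mk_bop (pairing_linear f) (@pairing_bound f).

Lemma lip0_dual_linear : linear lip0_dual_fun.
Proof. by move=> a f g; apply: bopP => mu; rewrite /= /pairing linearP. Qed.

Lemma lip0_dual_bound f : `|lip0_dual_fun f| <= 1 * `|f|.
Proof. by rewrite mul1r; apply: op_norm_lub => //; exact: pairing_bound. Qed.

(* The canonical identification of Lip_0(M) with the dual of F(M); by
   lip0_dual_isometry and lip0_dual_surj it is an isometric isomorphism. *)
Definition lip0_dual : bop (lip0 o) (dual lip_free) :=
  mk_bop lip0_dual_linear lip0_dual_bound.

Lemma delta_free x : delta o x \in free_pred o.
Proof.
by apply/closure_predP/subset_closure/lspan_sub; exists x.
Qed.

Definition free_delta (x : M) : lip_free := Subnormed (delta_free x).

Lemma free_delta_dist x y : `|free_delta x - free_delta y| <= mdist x y.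
Proof.
apply: op_norm_lub; first exact: mdist_ge0.
by move=> f; have := lip_norm_le f x y; rewrite mulrC.
Qed.

Lemma lip0_dual_isometry : isometric_embedding lip0_dual.
Proof.
move=> f; apply/eqP; rewrite eq_le; apply/andP; split.
  by have := lip0_dual_bound f; rewrite mul1r.
apply: lip_norm_lub => // x y.
apply: (@le_trans _ _ (`|lip0_dual f| * `|free_delta x - free_delta y|)).
  exact: (op_norm_le (lip0_dual f) (free_delta x - free_delta y)).
by rewrite ler_wpM2l// free_delta_dist.
Qed.

Lemma lip0_dual_surj (phi : dual lip_free) : exists f, lip0_dual f = phi.
Proof.
have fP : (fun x => phi (free_delta x)) \in lip0_pred o.
  apply/lip0_predP; split.
    exists `|phi| => x y; rewrite -linearB.
    apply: le_trans (op_norm_le phi _) _.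
    by apply: ler_wpM2l; [exact: op_norm_ge0|exact: free_delta_dist].
  rewrite (_ : free_delta o = 0) ?linear0//.
  by apply/val_inj/bopP => f; exact: lip0_base.
pose f := Lip0 fP; exists f; apply: bopP => mu.
have spanE nu : lspan (range (delta o)) (subnormed_val nu) ->
    lip0_dual f nu = phi nu.
  move=> [n [c [a [aP nuE]]]].
  pose x i := sval (cid2 (aP i)).
  have xa i : delta o (x i) = a i by rewrite /x; case: cid2.
  have -> : nu = \sum_i c i *: free_delta (x i).
    apply: val_inj; rewrite raddf_sum/= [LHS]nuE; apply: eq_bigr => i _.
    by rewrite -xa.
  rewrite !linear_sum; apply: eq_bigr => i _.
  by rewrite !linearZ.
apply/eqP; rewrite -subr_eq0 -normr_le0; apply/ler_addgt0Pl => e e0.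
rewrite addr0.
pose D := lip0_dual f - phi.
have D1 : 0 < `|D| + 1 by rewrite ltr_wpDl.
have /closure_predP/closureE_dist := valP mu.
move=> /(_ (e / (`|D| + 1)) ltac:(by rewrite divr_gt0)) [w wspan muw].
have wP : w \in free_pred o by apply/closure_predP/subset_closure.
pose nu : lip_free := Subnormed wP.
have -> : lip0_dual f mu - phi mu = D (mu - nu).
  rewrite linearB/= -[LHS]subr0; congr (_ - _).
  by symmetry; apply/eqP; rewrite subr_eq0; apply/eqP/spanE.
apply: le_trans (op_norm_le D _) _.
apply: (@le_trans _ _ ((`|D| + 1) * `|mu - nu|)).
  by rewrite ler_wpM2r// lerDl.
by rewrite mulrC -ler_pdivlMr; [exact: ltW muw|].
Qed.

End spaces.
Arguments lip_free {R M} o.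
Arguments G0 {R M} o.
Arguments free_restriction {R M} o.
Arguments lip0_dual {R M} o.

(* Main.v *)
(* A compactly supported function can be made to agree with f in Lip_0(M) on any
   given finite set without increasing the Lipschitz constant: clamp f between
   -t and t, where t(x) = |f| max(0, 2r - d(x,0)) with r large. Hence R
   is isometric on the span of the evaluations, and by density on F(M).
   Hahn-Banach then lifts each functional on F(M) through R with the same norm,
   so that the adjoint of an isometry is a metric quotient map. Hahn-Banach
   itself is obtained from minimal sublinear functionals, which are linear. *)
Require Import Defs.
From HB Require Import structures.
From mathcomp Require Import all_boot all_order all_algebra.
From mathcomp Require Import all_classical all_reals all_analysis.
From mathcomp Require Import lra.

Set Implicit Arguments.
Unset Strict Implicit.
Unset Printing Implicit Defensive.

Import Order.TTheory GRing.Theory Num.Theory.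
Import numFieldNormedType.Exports.

Local Open Scope classical_set_scope.
Local Open Scope ring_scope.

(** * Sublinear functionals and Hahn-Banach *)

Section sublinear_functionals.
Context {R : realType} (V : lmodType R).
Implicit Types p q : V -> R.

Definition sublinear p :=
  (forall x y, p (x + y) <= p x + p y) /\
  (forall a x, 0 <= a -> p (a *: x) <= a * p x).

Lemma sublinear0 p : sublinear p -> p 0 = 0.
Proof.
move=> [pD pZ]; have := pZ 0 0 (lexx _); have := pD 0 0.
rewrite scale0r addr0 mul0r; lra.
Qed.

Lemma sublinear_opp p x : sublinear p -> - p (- x) <= p x.
Proof.
move=> sp; have := sp.1 x (- x); rewrite subrr (sublinear0 sp); lra.
Qed.

Lemma sublinearZ p a x : sublinear p -> 0 <= a -> p (a *: x) = a * p x.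
Proof.
move=> sp; rewrite le_eqVlt => /predU1P[<-|a0].
  by rewrite scale0r mul0r sublinear0.
apply/eqP; rewrite eq_le sp.2 ?(ltW a0)//=.
have := sp.2 a^-1 (a *: x); rewrite scalerA mulVf ?gt_eqF// scale1r.
by rewrite invr_ge0 ltW// => /(_ isT); rewrite ler_pdivlMl.
Qed.

(** A pair [(v, r)] stands for the constraint that a functional be at most [r] at [v]. *)
Definition convex_cone (C : set (V * R)) :=
  [/\ C (0, 0), forall u v, C u -> C v -> C (u + v) &
      forall a u, 0 <= a -> C u -> C (a *: u.1, a * u.2)].

(* The witness is the infimal convolution of [p] with the cone. *)
Lemma sublinear_below_cone p (C : set (V * R)) : sublinear p -> convex_cone C ->
  (forall v r, C (v, r) -> 0 <= p (- v) + r) ->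
  exists q, [/\ sublinear q, forall x, q x <= p x &
    forall v r, C (v, r) -> q v <= r].
Proof.
move=> sp [C0 CD CZ] Cp.
pose E x := [set p (x - u.1) + u.2 | u in C].
(* Since [- v = (x - v) + (- x)], subadditivity and the hypothesis on [C] keep the infimum
   finite. *)
have lbE x : has_lbound (E x).
  exists (- p (- x)) => _ [[v r] Cu <-] /=.
  have := sp.1 (x - v) (- x); rewrite addrAC subrr add0r.
  have := Cp v r Cu; lra.
have En0 x : E x !=set0 by exists (p (x - 0) + 0), (0, 0).
have qE x v r : C (v, r) -> inf (E x) <= p (x - v) + r.
  by move=> Cu; apply: ge_inf => //; exists (v, r).
exists (fun x => inf (E x)); split; last 2 first.
- by move=> x; have := qE x 0 0 C0; rewrite subr0 addr0.
- by move=> v r /(qE v); rewrite subrr (sublinear0 sp) add0r.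
split=> [x y|a x].
  rewrite -lerBlDr; apply: lb_le_inf => // _ [[u r] Cu <-] /=.
  rewrite lerBlDr -lerBlDl; apply: lb_le_inf => // _ [[v s] Cv <-] /=.
  rewrite lerBlDl (le_trans (qE _ (u + v) (r + s) (CD _ _ Cu Cv)))//.
  by rewrite opprD addrACA; have := sp.1 (x - u) (y - v); lra.
rewrite le_eqVlt => /predU1P[<-|a0].
  rewrite scale0r mul0r (le_trans (qE _ _ _ C0))//.
  by rewrite subr0 addr0 sublinear0.
rewrite -ler_pdivrMl//; apply: lb_le_inf => // _ [[u r] Cu <-] /=.
rewrite ler_pdivrMl// (le_trans (qE _ _ _ (CZ _ _ (ltW a0) Cu)))//=.
by rewrite -scalerBr (sublinearZ _ sp (ltW a0)) mulrDr.
Qed.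

(** The pointwise infimum works: it is finite as [q x >= - q (- x) >= - p (- x)], and subadditive
    because, of two chain members, the smaller one serves both summands. *)
Lemma sublinear_chain_lbound p (A : set (V -> R)) : A !=set0 ->
  (forall q, A q -> sublinear q) ->
  (forall q1 q2, A q1 -> A q2 ->
    (forall x, q1 x <= q2 x) \/ (forall x, q2 x <= q1 x)) ->
  (forall q, A q -> forall x, q x <= p x) ->
  exists q, sublinear q /\ forall q', A q' -> forall x, q x <= q' x.
Proof.
move=> A0 As Atot Ap.
pose E x := [set q x | q in A].
have lbE x : has_lbound (E x).
  exists (- p (- x)) => _ [q Aq <-].
  by have := sublinear_opp x (As q Aq); have := Ap q Aq (- x); lra.
have En0 x : E x !=set0 by have [q Aq] := A0; exists (q x), q.
have qE x q : A q -> inf (E x) <= q x.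
  by move=> Aq; apply: ge_inf => //; exists q.
exists (fun x => inf (E x)); split; last by move=> q' Aq' x; exact: qE.
split=> [x y|a x].
  rewrite -lerBlDr; apply: lb_le_inf => // _ [q1 Aq1 <-] /=.
  rewrite lerBlDr -lerBlDl; apply: lb_le_inf => // _ [q2 Aq2 <-] /=.
  rewrite lerBlDl.
  have [q12|q21] := Atot _ _ Aq1 Aq2.
    by have := qE (x + y) _ Aq1; have := (As _ Aq1).1 x y; have := q12 y; lra.
  by have := qE (x + y) _ Aq2; have := (As _ Aq2).1 x y; have := q21 x; lra.
rewrite le_eqVlt => /predU1P[<-|a0].
  rewrite scale0r mul0r; have [q Aq] := A0.
  by rewrite (le_trans (qE _ _ Aq))// (sublinear0 (As _ Aq)).
rewrite -ler_pdivrMl//; apply: lb_le_inf => // _ [q Aq <-] /=.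
by rewrite ler_pdivrMl// (le_trans (qE _ _ Aq))// (As _ Aq).2 ?ltW.
Qed.

Lemma exists_minimal_sublinear p : sublinear p ->
  exists q, [/\ sublinear q, forall x, q x <= p x &
    forall q', sublinear q' -> (forall x, q' x <= q x) ->
      forall x, q x <= q' x].
Proof.
move=> sp; pose T := {q | sublinear q /\ forall x, q x <= p x}.
(* The order is reversed, so that Zorn's maximal element is a minimal functional. *)
pose below (s t : T) := `[< forall x, sval t x <= sval s x >].
have tp : sublinear p /\ forall x, p x <= p x by [].
have [| | |[q [sq qp]] qmin] := @ZL_preorder T (exist _ p tp) below.
- by move=> t; apply/asboolP.
- by move=> r s t /asboolP rs /asboolP st; apply/asboolP => x; exact: le_trans (rs x).
- move=> A Atot; have [[t0 At0]|A0] := pselect (A !=set0); last first.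
    by exists (exist _ p tp) => s As; case: A0; exists s.
  have [| | | |q [sq qA]] := @sublinear_chain_lbound p (sval @` A).
  + by exists (sval t0), t0.
  + by move=> _ [t _ <-]; case: (svalP t).
  + move=> _ _ [s As <-] [t At <-].
    by have [/asboolP|/asboolP] := Atot _ _ As At; [right|left].
  + by move=> _ [t _ <-]; case: (svalP t).
  have qp x : q x <= p x.
    have [_ t0p] := svalP t0; apply: le_trans (t0p x).
    by apply: qA; exists t0.
  exists (exist _ q (conj sq qp)) => s As; apply/asboolP => x /=.
  by apply: qA; exists s.
exists q; split=> // q' sq' q'q.
have q'p x : q' x <= p x := le_trans (q'q x) (qp x).
by apply/asboolP/(qmin (exist _ q' (conj sq' q'p)))/asboolP.
Qed.

(* If q is minimal, lowering it along the ray of - y cannot change it. *)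
Lemma minimal_sublinear_oppr q : sublinear q ->
  (forall q', sublinear q' -> (forall x, q' x <= q x) ->
    forall x, q x <= q' x) ->
  forall y, q (- y) = - q y.
Proof.
move=> sq qmin y; apply/eqP; rewrite eq_le; apply/andP; split; last first.
  by have := sublinear_opp y sq; lra.
pose C := [set (- (t *: y), - (t * q y)) | t in [set t : R | 0 <= t]].
have [||q' [sq' q'q q'C]] := @sublinear_below_cone q C sq.
- split.
  + by exists 0 => //=; rewrite scale0r mul0r !oppr0.
  + move=> _ _ [s s0 <-] [t t0 <-]; exists (s + t) => /=.
      by rewrite addr_ge0.
    by rewrite scalerDl mulrDl !opprD.
  + move=> a _ a0 [t t0 <-]; exists (a * t) => /=; first by rewrite mulr_ge0.
    by rewrite -scalerA -mulrA scalerN mulrN.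
- move=> _ _ [t t0 [<- <-]].
  by rewrite opprK (sublinearZ _ sq t0) subrr.
apply: le_trans (qmin _ sq' q'q _) _; apply: q'C.
by exists 1; rewrite /= ?ler01// scale1r mul1r.
Qed.

(** Subadditivity at [x + y] and [- y] becomes superadditivity once [q] is odd; oddness also reduces
    negative scalars to positive ones. *)
Lemma odd_sublinear_linear q : sublinear q -> (forall y, q (- y) = - q y) ->
  linear (q : V -> R^o).
Proof.
move=> sq qN; have qD x y : q (x + y) = q x + q y.
  apply/eqP; rewrite eq_le sq.1/=; have := sq.1 (x + y) (- y).
  by rewrite addrK qN; lra.
have qZ a x : q (a *: x) = a * q x.
  have [a0|a0] := leP 0 a; first exact: sublinearZ.
  by rewrite -[a]opprK scaleNr qN sublinearZ ?oppr_ge0 ?ltW// !mulNr.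
by move=> a x y; rewrite qD qZ.
Qed.

Lemma hahn_banach_cone p (C : set (V * R)) : sublinear p -> convex_cone C ->
  (forall v r, C (v, r) -> 0 <= p (- v) + r) ->
  exists f : V -> R^o, [/\ linear f, forall x, f x <= p x &
    forall v r, C (v, r) -> f v <= r].
Proof.
move=> sp cC Cp; have [q0 [sq0 q0p q0C]] := sublinear_below_cone sp cC Cp.
have [q [sq qq0 qmin]] := exists_minimal_sublinear sq0.
exists q; split.
- exact: odd_sublinear_linear sq (minimal_sublinear_oppr sq qmin).
- by move=> x; exact: le_trans (qq0 x) (q0p x).
- by move=> v r Cv; exact: le_trans (qq0 v) (q0C _ _ Cv).
Qed.

End sublinear_functionals.

(** * Truncation to compact support *)

Section clamping.
Context {R : realType} (M : metricType R) (o : M).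

Definition tent (L r : R) (x : M) : R := L * Num.max 0 (r - mdist x o).

(** Minimum and maximum are nonexpansive for the sup distance on pairs. *)
Lemma clamp_dist (C a b a' b' : R) : `|a - a'| <= C -> `|b - b'| <= C ->
  `|Num.max (- b) (Num.min a b) - Num.max (- b') (Num.min a' b')| <= C.
Proof.
rewrite !ler_norml => /andP[? ?] /andP[? ?].
case: (leP a b) => ?; case: (leP a' b') => ?;
  case: (leP (- b)) => ?; case: (leP (- b')) => ?; apply/andP; split; lra.
Qed.

Lemma tent_dist L r x y : 0 <= L -> `|tent L r x - tent L r y| <= L * mdist x y.
Proof.
move=> L0; rewrite -mulrBr normrM (ger0_norm L0) ler_wpM2l//.
have := metric_triangle x y o; have := metric_triangle y x o.
rewrite (metric_sym y x) ler_norml => ? ?; have := mdist_ge0 x y => ?.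
by case: (leP 0 (r - mdist x o)) => ?; case: (leP 0 (r - mdist y o)) => ?;
  apply/andP; split; lra.
Qed.

(* Clamping [f] between [- t] and [t], where [t] is a tent of height [2 r `|f|]
   at [o], keeps the Lipschitz constant, and leaves [f] unchanged where
   [`|f| * mdist x o <= t x], that is on the ball of radius [r]. *)
Lemma lip0_compact_truncation (f : lip0 o) (r : R) :
  proper_metric_space M ->
  exists g : lip0 o, [/\ lip0c o g, `|g| <= `|f| &
    forall x, mdist x o <= r -> g x = f x].
Proof.
move=> Mp; pose L : R := `|f|; have L0 : 0 <= L by exact: normr_ge0.
pose t := tent L (2 * r).
have t0 x : 0 <= t x by rewrite mulr_ge0// le_max lexx.
pose g x := Num.max (- t x) (Num.min (f x) (t x)).
have gL x y : `|g x - g y| <= L * mdist x y.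
  by apply: clamp_dist; [exact: (lip_norm_le f)|exact: tent_dist].
have gP : (g : M -> R^o) \in lip0_pred o.
  apply/lip0_predP; split; first by exists L.
  by rewrite /g lip0_base min_l// max_r// oppr_le0.
exists (Lip0 gP); split.
- apply: Mp; first exact: closed_closure.
  (* The tent, hence [g], vanishes beyond radius [2 * r]; the extra 1 pays for passing to the
     closure, and the absolute value covers negative [r]. *)
  have d2 x : lip_support (Lip0 gP) x -> mdist x o <= 1 + `|2 * r|.
    move=> /(_ (ball x 1) (nbhsx_ballx _ _ ltr01))[y [/= gy]].
    rewrite ballEmdist/= => xy; apply: le_trans (metric_triangle x y o) _.
    apply: lerD; first exact: ltW.
    rewrite (le_trans _ (ler_norm _))// leNgt; apply/negP => ry.
    have ty : t y = 0 by rewrite /t /tent max_l ?mulr0// subr_le0 ltW.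
    by apply: gy; rewrite /g ty oppr0 max_l// ge_min lexx orbT.
  exists (1 + `|2 * r| + (1 + `|2 * r|)) => x y /d2 xo /d2 yo.
  apply: le_trans (metric_triangle x o y) _.
  by rewrite (metric_sym o y) lerD.
- exact: lip_norm_lub.
- move=> x xr; rewrite /= /g.
  have /andP[? ?] : - t x <= f x <= t x.
    rewrite -ler_norml; have := lip_norm_le f x o; rewrite lip0_base subr0.
    move=> /le_trans; apply; rewrite /t /tent ler_wpM2l//.
    by rewrite le_max; apply/orP; right; lra.
  by rewrite min_l// max_r.
Qed.

End clamping.

(** * The restriction map is isometric *)

Section isometry.
Context {R : realType} (M : metricType R) (o : M).

Lemma span_delta_norm_le (M_proper : proper_metric_space M)
    (mu : lip_free o) :
  lspan (range (delta o)) (subnormed_val mu) -> `|mu| <= `|free_restriction o mu|.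
Proof.
move=> [n [c [a [aP muE]]]]; apply: op_norm_lub => // f.
pose x i := sval (cid2 (aP i)).
have xa i : delta o (x i) = a i by rewrite /x; case: cid2.
(* The sum of the distances to [o] is a radius that reaches every [x i]. *)
have [g [gc gf gE]] :=
  lip0_compact_truncation f (\sum_i mdist (x i) o) M_proper.
have gG : g \in G0_pred o by apply/closure_predP/subset_closure.
have -> : subnormed_val mu f = subnormed_val mu g.
  rewrite muE; elim/big_ind: _ => [//|u v uE vE|i _].
    by change (u f + v f = u g + v g); rewrite uE vE.
  rewrite -xa; change (c i *: (f (x i) : R^o) = c i *: (g (x i) : R^o)).
  rewrite gE// (bigD1 i)//= lerDl sumr_ge0// => j _; exact: mdist_ge0.
apply: le_trans (op_norm_le (free_restriction o mu) (Subnormed gG)) _.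
by apply: ler_wpM2l; [exact: op_norm_ge0|exact: gf].
Qed.

Lemma free_restriction_isometry (M_proper : proper_metric_space M) :
  isometric_embedding (free_restriction o).
Proof.
move=> mu; apply/eqP; rewrite eq_le; apply/andP; split.
  by have := free_restriction_bound mu; rewrite mul1r.
apply/ler_addgt0Pl => e e0.
have /closure_predP/closureE_dist := valP mu.
(* The error [mu - nu] is paid twice, once in [F(M)] and once after restriction, hence [e / 2]. *)
move=> /(_ (e / 2) ltac:(by rewrite divr_gt0)) [w wspan muw].
have wP : w \in free_pred o by apply/closure_predP/subset_closure.
pose nu : lip_free o := Subnormed wP.
have munu : `|mu - nu| < e / 2 by exact: muw.
have h1 := span_delta_norm_le M_proper (mu := nu) wspan.
have h2 : `|free_restriction o (nu - mu)| <= `|mu - nu|.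
  by rewrite distrC; have := free_restriction_bound (nu - mu); rewrite mul1r.
have h3 : `|mu| <= `|mu - nu| + `|nu|.
  by have := ler_normD (mu - nu) nu; rewrite subrK.
have h4 : `|free_restriction o nu| <=
    `|free_restriction o (nu - mu)| + `|free_restriction o mu|.
  have := ler_normD (free_restriction o (nu - mu)) (free_restriction o mu).
  by rewrite -linearD subrK.
lra.
Qed.

End isometry.

(** * Adjoints of contractions and isometries *)

Section duality.
Context {R : realType} (V W : normedModType R).

Lemma adjoint_contractive (T : bop V W) : (forall x, `|T x| <= `|x|) ->
  contractive (adjoint T).
Proof.
move=> T1 psi; apply: op_norm_lub => // x.
apply: le_trans (op_norm_le psi (T x)) _.
by apply: ler_wpM2l; [exact: op_norm_ge0|exact: T1].
Qed.

Lemma adjoint_weak_star_continuous (T : bop V W) :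
  weak_star_continuous (adjoint T).
Proof.
apply: continuous_comp_initial => psi.
have Fpsi : Filter (nbhs (psi : weak_star W)) by exact: nbhs_filter.
apply/pointwise_cvgP => x.
(* The adjoint followed by evaluation at [x] is evaluation at [T x]. *)
have ev : continuous (fun phi : weak_star W => (phi : dual W) (T x) : R).
  move=> phi; apply: (@continuous_comp (weak_star W) {ptws W -> R} R
    (fun phi => ((phi : dual W) : W -> R)) (@proj W (fun=> R) (T x))).
    exact: initial_continuous.
  exact: proj_continuous.
exact: ev.
Qed.

(* Hahn-Banach, transporting [phi] to the range of [T] and extending it to [W]
   with the same norm. *)
Lemma isometry_adjoint_lift (T : bop V W) (phi : dual V) :
  isometric_embedding T ->
  exists2 psi : dual W, adjoint T psi = phi & `|psi| <= `|phi|.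
Proof.
move=> Tiso; pose p (w : W) : R := `|phi| * `|w|.
(* This cone is a linear subspace, so the constraints at [v] and [- v] together force
   [f (T v) = phi v]. *)
pose C := [set (T v, phi v : R) | v in [set: V]].
have [| | |f [lf fp fC]] := @hahn_banach_cone R W p C.
- split=> [x y|a x a0].
    by rewrite -mulrDr ler_wpM2l// ler_normD.
  by rewrite /p normrZ (ger0_norm a0) mulrCA.
- split.
  + by exists 0 => //; rewrite !linear0.
  + by move=> _ _ [u _ <-] [v _ <-]; exists (u + v) => //; rewrite !linearD.
  + by move=> a _ _ [u _ <-]; exists (a *: u) => //; rewrite !linearZ.
- move=> _ _ [v _ [<- <-]]; rewrite /p normrN Tiso.
  have := op_norm_le phi v; rewrite ler_norml => /andP[].
  by rewrite -subr_ge0 opprK addrC.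
have fN x : f (- x) = - f x.
  pose L := GRing.isLinear.Build R W R^o *:%R f lf.
  pose g : {linear W -> R^o} := HB.pack f L.
  exact: (linearN g).
have fb x : `|f x| <= `|phi| * `|x|.
  rewrite ler_norml fp andbT; have := fp (- x).
  by rewrite fN /p normrN lerNl.
exists (mk_bop lf fb); last exact: op_norm_lub.
apply: bopP => v; apply/eqP; rewrite eq_le; apply/andP; split.
  by apply: fC; exists v.
have : f (T (- v)) <= phi (- v) by apply: fC; exists (- v).
by rewrite !linearN fN lerN2.
Qed.

Lemma adjoint_isometry_quotient (T : bop V W) :
  isometric_embedding T -> metric_quotient_map (adjoint T).
Proof.
move=> Tiso.
have Tc : contractive (adjoint T) by apply: adjoint_contractive => x; rewrite Tiso.
split=> [phi|psi].
  by have [psi] := isometry_adjoint_lift phi Tiso; exists psi.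
(* The adjoint is constant on the coset and contractive. *)
have lb : lbound [set `|v| | v in ker_coset (adjoint T) psi] `|adjoint T psi|.
  move=> _ [_ [z /= Tz <-] <-]; apply: le_trans (Tc _).
  by rewrite linearD [X in _ + X]Tz addr0.
apply/eqP; rewrite eq_le; apply/andP; split.
  apply: lb_le_inf => //; exists `|psi|, psi => //.
  by exists 0; [exact: (linear0 (adjoint T))|exact: addr0].
(* The norm-preserving lift lies in the coset of [psi], so the infimum is attained there. *)
have [psi' Tpsi' npsi'] := isometry_adjoint_lift (adjoint T psi) Tiso.
apply: le_trans npsi'; apply: ge_inf; first by exists `|adjoint T psi|.
exists psi' => //; exists (psi' - psi); last by rewrite addrC subrK.
have := linearB (adjoint T) psi' psi; rewrite [X in _ = X - _]Tpsi' subrr.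
exact.
Qed.

End duality.

(* F(M)^* is identified with Lip_0(M) through lip0_dual *)
Theorem proposition3p4 (R : realType) (M : metricType R) (o : M)
    (M_proper : proper_metric_space M) :
  [/\ isometric_embedding (free_restriction o),
      contractive (adjoint (free_restriction o)),
      weak_star_continuous (adjoint (free_restriction o)),
      metric_quotient_map (adjoint (free_restriction o)) &
      forall g : G0 o,
        adjoint (free_restriction o) (bidual_map g) =
        lip0_dual o (subnormed_val g)].
Proof.
have iso := free_restriction_isometry (o := o) M_proper.
split=> //.
- by apply: adjoint_contractive => mu; rewrite iso.
- exact: adjoint_weak_star_continuous.
- exact: adjoint_isometry_quotient.
(* Both sides unfold to the value of [mu] at [g]. *)
- by move=> g; apply: bopP.
Qed.
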